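(* Let $G$ be a nonempty finite simple graph of order $n$ (that is, $n = |V(G)| \geq 1$). Then \[ \gamma_2(G) \leq n - m(G) + 1, \] where $\gamma_2(G)$ is the 2-domination number of $G$ and $m(G)$ is the upper median degree of $G$.
   Context: All graphs are finite and simple; $G$ is not assumed to be connected. A set $D \subseteq V(G)$ is 2-dominating if every vertex in $V(G) \setminus D$ has at least two neighbors in $D$. The 2-domination number $\gamma_2(G)$ is the minimum cardinality of a 2-dominating set of $G$. If the degree sequence of an $n$-vertex graph $G$ is written in nondecreasing order as $d_1 \leq d_2 \leq \cdots \leq d_n$, the upper median degree of $G$ is $m(G) = d_{\lfloor n/2 \rfloor + 1}$. *)

(* Defs.v *)
From mathcomp Require Import all_boot.

Set Implicit Arguments.
Unset Strict Implicit.
Unset Printing Implicit Defensive.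

(* A finite simple graph on the vertex type V is a symmetric, irreflexive
   adjacency relation e : rel V. *)
Section Graph.

Variables (V : finType) (e : rel V).

Definition neighbors (v : V) : {set V} := [set w | e v w].

Definition degree (v : V) : nat := #|neighbors v|.

Definition two_dominating (D : {set V}) : bool :=
  [forall v : V, (v \notin D) ==> (2 <= #|neighbors v :&: D|)].

Lemma two_dominatingT : two_dominating [set: V].
Proof. by apply/forallP => v; rewrite in_setT. Qed.

(* By two_dominatingT, setT is an admissible starting point of the argmin. *)
Definition gamma2 : nat :=
  #|[arg min_(D < [set: V] | two_dominating D) #|D|]|.

Definition degree_sequence : seq nat := sort leq [seq degree v | v <- enum V].

(* Sequences are indexed from 0, so d_(floor(n/2) + 1) is the entry of index
   n./2, which is in range as soon as V is nonempty. *)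
Definition upper_median_degree : nat := nth 0 degree_sequence #|V|./2.

End Graph.

(* Main.v *)
Require Import Defs.
From mathcomp Require Import all_boot all_order all_algebra.
From mathcomp Require Import zify.

(** Write [m] for the upper median degree. It suffices to find a set [S] of
    [m - 1] vertices each having two neighbours outside [S]: the complement of
    [S] is then 2-dominating. A vertex of [S] of degree at least [m] has at most
    [m - 2] neighbours in [S], hence is automatically fine
    ([gamma2_le_compl]). Let [H] be the set of vertices of degree at least [m]
    and [L] its complement; by definition of the median, [#|L| <= #|H|]
    ([card_low_degree]). If [H] has at least [m - 1] elements, any [S] inside
    [H] works.

    Otherwise put [k = m - 1 - #|H|]. A vertex of [H] has at most [#|H| - 1]
    neighbours in [H], hence at least [k + 2] neighbours in [L]. Regard each
    vertex of [H] as a hyperedge on [L], namely its set of neighbours there. If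
    some [B] inside [H] covers [#|B| + k] vertices of [L] at least twice, and
    [A] consists of exactly [#|B| + k] of these, then [S = (H minus B) + A] has
    [m - 1] elements, and each vertex of [A] has two neighbours in [B], which is
    outside [S].

    Such a [B] exists by [double_cover]: a nonempty family of at least [n - k]
    hyperedges of size at least [k + 2] on [n] points always
    contains [j] hyperedges that cover [j + k] points at least twice, for some
    [j]. For [k = 0] and hyperedges of size two
    this follows from the existence of a cycle in a graph with at least as many
    edges as vertices, and the proof generalizes the usual reduction: points of
    degree at most one are deleted with their hyperedge and surplus hyperedges
    are dropped, until every point has degree at least two and there are exactly
    [n - k] hyperedges, which then form the solution. *)

Set Implicit Arguments.
Unset Strict Implicit.
Unset Printing Implicit Defensive.

(** * Doubly covered points in hypergraphs *)

Section DoubleCover.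

Variables (I T : finType) (N : I -> {set T}).
Implicit Types (E B : {set I}) (X : {set T}).

Definition star B (v : T) : {set I} := [set b in B | v \in N b].

Definition doubly_covered B : {set T} := [set v | 2 <= #|star B v|].

Lemma star_subset B v : star B v \subset B.
Proof. by apply/subsetP => b; rewrite inE => /andP[]. Qed.

(** The hypotheses survive the deletion of a point of degree at most one together
    with its hyperedge, as well as the removal of a surplus hyperedge. When
    neither reduction applies, all points are doubly covered by [E] and
    [#|X| = #|E| + k], so that [E] itself is a solution. *)
Lemma double_cover k X E :
    E != set0 -> (forall b, b \in E -> N b \subset X) ->
    (forall b, b \in E -> k.+2 <= #|N b|) -> #|X| <= #|E| + k ->
  exists2 B : {set I}, B \subset E & #|B| + k <= #|doubly_covered B|.
Proof.
have [n] := ubnP (#|E| + #|X|); elim: n => // n IHn in X E *.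
rewrite ltnS => leEXn E0 NX leN leX.
have [b0 b0E] := set0Pn _ E0.
(* Being larger than [k + 1], [X] keeps [E] nonempty in both reductions. *)
have gtX : k.+2 <= #|X|.
  exact: leq_trans (leN _ b0E) (subset_leq_card (NX _ b0E)).
have reduce X' E' :
    E' \subset E -> #|E'| + #|X'| < #|E| + #|X| -> E' != set0 ->
    (forall b, b \in E' -> N b \subset X') -> #|X'| <= #|E'| + k ->
  exists2 B : {set I}, B \subset E & #|B| + k <= #|doubly_covered B|.
  move=> /subsetP subE' lt' E'0 NX' leX'.
  have [b /subE'/leN//|B BE' leB] := IHn X' E' (leq_trans lt' leEXn) E'0 NX' _ leX'.
  by exists B => //; apply: subset_trans BE' (introT subsetP subE').
have [/exists_inP[v vX deg_v]|/exists_inPn no_low] :=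
  boolP [exists v in X, #|star E v| <= 1].
  have cX := cardsD1 v X; rewrite vX in cX.
  have cE := cardsD E (star E v); rewrite (setIidPr (star_subset E v)) in cE.
  apply: (reduce (X :\ v) (E :\: star E v)); rewrite ?subsetDl -?card_gt0; try lia.
  move=> b /setDP[bE]; rewrite inE bE /= => vb.
  by rewrite subsetD1 NX.
have deg_ge2 v : v \in X -> 2 <= #|star E v| by move/no_low; rewrite -ltnNge.
have [eqX|neqX] := eqVneq #|X| (#|E| + k).
  exists E => //; rewrite -eqX; apply/subset_leq_card/subsetP => v vX.
  by rewrite inE deg_ge2.
have gtE : 1 < #|E|.
  have /card_gt0P[v vX] : 0 < #|X| by lia.
  exact: leq_trans (deg_ge2 v vX) (subset_leq_card (star_subset E v)).
have cE := cardsD1 b0 E; rewrite b0E in cE.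
apply: (reduce X (E :\ b0)); rewrite ?subsetDl -?card_gt0; try lia.
by move=> b /setD1P[_]; apply: NX.
Qed.

End DoubleCover.

(** * Counting lemmas *)

Lemma exists_subset_card (T : finType) (A : {set T}) s :
  s <= #|A| -> exists2 S : {set T}, S \subset A & #|S| = s.
Proof.
move=> sA; have : 0 < 'C(#|A|, s) by rewrite bin_gt0.
rewrite -cards_draws => /card_gt0P[S]; rewrite inE => /andP[SA /eqP cS].
by exists S.
Qed.

(** Only the entries before position [i] can be smaller than the entry there. *)
Lemma count_lt_sorted_nth (s : seq nat) i :
  sorted leq s -> count (fun x => x < nth 0 s i) s <= i.
Proof.
move=> srt; have [si|si] := leqP (size s) i.
  by apply: leq_trans (count_size _ _) si.
rewrite -{2}(cat_take_drop i s) count_cat.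
have -> : count (fun x => x < nth 0 s i) (drop i s) = 0.
  apply/eqP; rewrite -leqn0 leqNgt -has_count; apply/hasPn => x.
  move=> /(nthP 0)[j]; rewrite size_drop nth_drop => jlt <-; rewrite -leqNgt.
  by apply: (sorted_leq_nth leq_trans leqnn 0 srt); rewrite ?inE ?leq_addr -?ltn_subRL.
rewrite addn0; apply: leq_trans (count_size _ _) _.
by rewrite size_take si.
Qed.

(** * Two-domination and the median degree *)

Section TwoDomination.

Variables (V : finType) (e : rel V).

Lemma gamma2_le (D : {set V}) : two_dominating e D -> gamma2 e <= #|D|.
Proof.
rewrite /gamma2 => domD; case: arg_minnP; first exact: two_dominatingT.
by move=> D0 _; apply.
Qed.

Lemma card_low_degree :
  #|[set v | degree e v < upper_median_degree e]| <= #|V|./2.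
Proof.
have := @count_lt_sorted_nth (degree_sequence e) #|V|./2
          (sort_sorted leq_total _).
rewrite -/(upper_median_degree e) /degree_sequence count_sort count_map.
by rewrite enumT cardsE cardE /enum_mem size_filter.
Qed.

(** A vertex of [S] has at most [#|S| - 1] neighbours in [S], so degree above
    [#|S|] forces two neighbours outside. *)
Lemma gamma2_le_compl (S : {set V}) :
    irreflexive e ->
    (forall v, v \in S -> #|S| < degree e v \/ 2 <= #|neighbors e v :\: S|) ->
  gamma2 e + #|S| <= #|V|.
Proof.
move=> e_irr HS; rewrite -(cardsC S) addnC leq_add2l; apply: gamma2_le.
apply/forallP => v; rewrite inE negbK; apply/implyP => vS; rewrite -setDE.
have [degv|//] := HS v vS.
have sub : neighbors e v :&: S \subset S :\ v.
  apply/subsetP => u; rewrite !inE => /andP[evu ->]; rewrite andbT.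
  by apply: contraTneq evu => ->; rewrite e_irr.
have := subset_leq_card sub; have := cardsD1 v S; rewrite vS.
have := cardsID S (neighbors e v); rewrite -/(degree e v); lia.
Qed.

Lemma gamma2_add_median_le :
  symmetric e -> irreflexive e -> 0 < #|V| ->
  gamma2 e + upper_median_degree e <= #|V|.+1.
Proof.
move=> e_sym e_irr V0; set m := upper_median_degree e.
suff [S cS HS] : exists2 S : {set V}, #|S| = m.-1 &
    forall v, v \in S -> m <= degree e v \/ 2 <= #|neighbors e v :\: S|.
  (* For [m = 0] the set [S] is empty, and the predecessor loses nothing since
     the bound to prove is then [#|V| + 1]. *)
  have : gamma2 e + #|S| <= #|V|.
    apply: gamma2_le_compl => // v vS; case: (HS v vS); last by right.
    have : 0 < #|S| by apply/card_gt0P; exists v.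
    by left; lia.
  lia.
pose L := [set v | degree e v < m]; pose H := ~: L.
have HP v : (v \in H) = (m <= degree e v) by rewrite !inE -leqNgt.
have cLH : #|L| + #|H| = #|V| by apply: cardsC.
have leL : #|L| <= #|V|./2 by apply: card_low_degree.
have [bigH|smallH] := leqP m.-1 #|H|.
  have [S /subsetP SH cS] := exists_subset_card bigH.
  by exists S => // v /SH; rewrite HP; left.
have [|b _|b bH||B BH] :=
  @double_cover V V (fun b => neighbors e b :&: L) (m.-1 - #|H|) L H.
- by rewrite -card_gt0; lia.
- exact: subsetIr.
- have sub : neighbors e b :\: L \subset H :\ b.
    apply/subsetP => u; rewrite in_setD in_setD1 [u \in H]in_setC => /andP[-> ebu].
    by rewrite andbT; apply: contraTneq ebu => ->; rewrite inE e_irr.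
  have := subset_leq_card sub; have := cardsD1 b H; rewrite bH.
  have := cardsID L (neighbors e b); rewrite -/(degree e b).
  move: (bH); rewrite HP; lia.
- lia.
move=> /exists_subset_card[A /subsetP AL cA].
have AsubL v : v \in A -> v \in L.
  move/AL; rewrite inE => /ltnW/card_gt0P[b].
  by rewrite inE => /andP[_ /setIP[]].
exists ((H :\: B) :|: A).
  rewrite cardsU cA cardsD (setIidPr BH).
  have -> : (H :\: B) :&: A = set0.
    apply/setP => u; rewrite !inE -!andbA; apply/negP => /and3P[_ Hu /AsubL].
    by rewrite inE (negbTE Hu).
  by have := subset_leq_card BH; rewrite cards0; lia.
move=> v /setUP[/setDP[vH _]|vA]; [by left; rewrite -HP | right].
have := AL v vA; rewrite inE => /leq_trans; apply.
apply/subset_leq_card/subsetP => b; rewrite !in_set => /and3P[bB vb _].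
rewrite e_sym vb bB andbT /=.
by apply/negP => /AsubL; have := subsetP BH b bB; rewrite in_setC => /negbTE->.
Qed.

End TwoDomination.

Local Open Scope ring_scope.

Theorem theorem1 (V : finType) (e : rel V)
    (e_sym : symmetric e) (e_irr : irreflexive e) (V_gt0 : (0 < #|V|)%N) :
  (gamma2 e)%:Z <= #|V|%:Z - (upper_median_degree e)%:Z + 1.
Proof.
have := gamma2_add_median_le e_sym e_irr V_gt0; lia.
Qed.
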